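(* Let $X$ be a locally compact non-compact metrizable space. Then $\lambda(\mathcal{E}_K(X))$ consists of exactly those elements of $\lambda(\mathcal{E}(X))$ which are clopen in $X^*$.
   Context: For a non-compact metrizable space $X$, $\mathcal{E}(X)$ denotes the set of all one-point metrizable extensions of $X$, i.e. metrizable spaces $Y=X\cup\{p\}$ with $p\notin X$ containing $X$ as a dense subspace, where two such extensions are identified if there is a homeomorphism between them fixing $X$ pointwise. For $X$ locally compact, $\mathcal{E}_K(X)$ is the set of those elements of $\mathcal{E}(X)$ that are locally compact. $\beta X$ is the Stone-Čech compactification of $X$; for $A\subseteq X$, $A^*=(\mathrm{cl}_{\beta X}A)\setminus X$, so $X^*=\beta X\setminus X$. $\mathcal{Z}(T)$ denotes the set of all zero-sets $f^{-1}(0)$ of continuous functions $f:T\to\mathbb{R}$. A sequence $\{U_n\}_{n<\omega}$ of non-empty open subsets of $X$ is an extension trace in $X$ if $\mathrm{cl}_XU_{n+1}\subseteq U_n$ for each $n$ and $\bigcap_nU_n=\emptyset$. It generates $Y=X\cup\{p\}\in\mathcal{E}(X)$ if $\{U_n\cup\{p\}\}_{n<\omega}$ is an open base at $p$ in $Y$; every extension trace generates an element of $\mathcal{E}(X)$ and every element of $\mathcal{E}(X)$ is generated by an extension trace. For locally compact $X$, the map $\lambda:\mathcal{E}(X)\to\mathcal{Z}(X^* )$ is $\lambda(Y)=\bigcap_{n<\omega}U_n^*$, where $\{U_n\}$ is any extension trace generating $Y$ (this is well-defined and injective). *)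

(* Defs.v *)
From HB Require Import structures.
From mathcomp Require Import all_boot all_order all_algebra.
From mathcomp Require Import all_classical all_reals topology normedtype.
From mathcomp Require Import interval_inference.

Set Implicit Arguments.
Unset Strict Implicit.
Unset Printing Implicit Defensive.

Import Order.TTheory GRing.Theory Num.Theory.
Import numFieldNormedType.Exports.

Local Open Scope classical_set_scope.
Local Open Scope ring_scope.

Definition homeomorphism (S T : topologicalType) (f : S -> T) :=
  exists g : T -> S, [/\ cancel f g, cancel g f, continuous f & continuous g].

Definition embedding (S T : topologicalType) (f : S -> T) :=
  injective f /\
  forall U : set S, open U <-> exists2 V : set T, open V & f @^-1` V = U.

Definition metrizable (R : realType) (T : topologicalType) :=
  exists (M : metricType R) (h : T -> M), homeomorphism h.

Section stone_cech.
Variables (R : realType) (X : topologicalType).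

(* The closure of the image of X in the cube of all its continuous [0, 1]-valued
   functions.  For a metrizable X, [stone_cech_incl_embedding] below shows that
   X embeds in it, and [stone_cech_ext] extends the functions of the family. *)
Definition unit_functions : set (X -> R) :=
  [set f : X -> R | continuous f /\ range f `<=` `[0, 1]].

Definition evaluation : X -> prod_topology (fun _ : unit_functions => R) :=
  join_product (fun f : unit_functions => \val f).

Definition stone_cech : topologicalType := closure (range evaluation).

Definition stone_cech_incl (x : X) : stone_cech :=
  exist _ (evaluation x) (mem_set (subset_closure (imageT evaluation x))).

Definition remainder : topologicalType :=
  (~` range stone_cech_incl : set stone_cech).

(* A^* as a subset of the space X^*: the trace on X^* of the closure of A. *)
Definition star (A : set X) : set remainder :=
  \val @^-1` closure (stone_cech_incl @` A).

End stone_cech.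
Arguments unit_functions : clear implicits.

Record one_point_extension (R : realType) (X : topologicalType) := {
  ope_space :> topologicalType ;
  ope_incl : X -> ope_space ;
  ope_pt : ope_space ;
  ope_metrizable : metrizable R ope_space ;
  ope_embedding : embedding ope_incl ;
  ope_range : range ope_incl = ~` [set ope_pt] ;
  ope_dense : dense (range ope_incl)
}.

Section extensions.
Variables (R : realType) (X : topologicalType).
Implicit Types (Y : one_point_extension R X) (U : nat -> set X).

(* An element of E(X) is a whole equivalence class for [ope_equiv].  Classes and
   families of classes are plain predicates because [set] lives in too small a
   universe to contain sets of topological spaces. *)
Definition ope_equiv Y Y' :=
  exists2 f : Y -> Y', homeomorphism f &
    forall x, f (ope_incl Y x) = ope_incl Y' x.

Definition extensions (C : one_point_extension R X -> Prop) :=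
  exists Y, C = ope_equiv Y.

Definition lc_extensions (C : one_point_extension R X -> Prop) :=
  extensions C /\ exists2 Y, C Y & locally_compact [set: Y].

Definition extension_trace U :=
  [/\ forall n, open (U n), forall n, U n !=set0,
      forall n, closure (U n.+1) `<=` U n & \bigcap_n U n = set0].

Definition generates U Y :=
  let V n := ope_pt Y |` ope_incl Y @` U n in
  (forall n, open (V n)) /\
  (forall W, nbhs (ope_pt Y) W -> exists n, V n `<=` W).

(* [exists_trace] and [lambdaE] below show that a trace always exists and that
   the value does not depend on which one [xget] picks. *)
Definition lambda (C : one_point_extension R X -> Prop) :
    set (remainder R X) :=
  let U := xget (fun=> set0)
    [set U | extension_trace U /\ exists2 Y, C Y & generates U Y] in
  \bigcap_n star (U n).

Definition lambda_image (E : (one_point_extension R X -> Prop) -> Prop) :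
    set (set (remainder R X)) :=
  [set Z | exists2 C, E C & lambda C = Z].

End extensions.

Section topological_facts.
Variable R : realType.

Lemma homeo_nbhs (S T : topologicalType) (f : S -> T) (x : S) (A : set T) :
  homeomorphism f -> nbhs x (f @^-1` A) <-> nbhs (f x) A.
Proof.
move=> [g [fg gf cf cg]]; split; last exact: cf.
move=> nA; have := cg (f x) (f @^-1` A); rewrite fg => /(_ nA).
by rewrite nbhs_simpl/=; apply: filterS => y /=; rewrite gf.
Qed.

Lemma homeo_open (S T : topologicalType) (f : S -> T) (A : set T) :
  homeomorphism f -> open (f @^-1` A) <-> open A.
Proof.
move=> hf; rewrite !openE; split => [oA y Ay|oA x Ax]; last first.
  by apply/(homeo_nbhs _ _ hf); exact: oA.
have [g [fg gf _ _]] := hf; rewrite -(gf y); apply/(homeo_nbhs _ _ hf).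
by apply: oA; rewrite /= gf.
Qed.

Lemma homeo_inv (S T : topologicalType) (f : S -> T) :
  homeomorphism f -> exists g : T -> S, [/\ homeomorphism g, cancel f g & cancel g f].
Proof. by move=> [g [fg gf cf cg]]; exists g; split=> //; exists f. Qed.

Lemma homeo_comp (S T U : topologicalType) (f : S -> T) (g : T -> U) :
  homeomorphism f -> homeomorphism g -> homeomorphism (g \o f).
Proof.
move=> [f' [ff' f'f cf cf']] [g' [gg' g'g cg cg']]; exists (f' \o g'); split.
- exact: can_comp.
- exact: can_comp.
- by move=> x; apply: continuous_comp; [exact: cf|exact: cg].
- by move=> x; apply: continuous_comp; [exact: cg'|exact: cf'].
Qed.

Lemma homeo_closure (S T : topologicalType) (f : S -> T) (A : set T) :
  homeomorphism f -> closure (f @^-1` A) = f @^-1` closure A.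
Proof.
move=> hf; apply/seteqP; split => x /= clA.
  move=> B /(homeo_nbhs _ _ hf)/clA[y [Ay By]].
  by exists (f y).
move=> B nB; have [g [hg fg gf]] := homeo_inv hf.
have : nbhs (f x) (g @^-1` B) by apply/(homeo_nbhs _ _ hg); rewrite fg.
move=> /clA [y [Ay By]]; exists (g y); split => //=.
by rewrite gf.
Qed.

Lemma homeo_compact (S T : topologicalType) (f : S -> T) (A : set T) :
  homeomorphism f -> compact (f @^-1` A) <-> compact A.
Proof.
move=> [g [fg gf cf cg]].
have E : A = f @` (f @^-1` A).
  apply/seteqP; split=> [y Ay|y [x /= ? <-//]]; exists (g y) => //=; by rewrite gf.
have E' : f @^-1` A = g @` A.
  apply/seteqP; split=> [y /= Ay|y [x /= ? <-//]]; last by rewrite /= gf.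
  by exists (f y).
split=> cA; [rewrite E|rewrite E']; apply: continuous_compact => //;
  exact: continuous_subspaceT.
Qed.

Lemma homeo_locally_compact (S T : topologicalType) (f : S -> T) :
  homeomorphism f -> locally_compact [set: S] -> locally_compact [set: T].
Proof.
move=> hf lcS y _; have [g [hg fg gf]] := homeo_inv hf.
have [A nA [cA clA]] := lcS (g y) I.
exists (g @^-1` A).
  have nA' : nbhs (g y) A by apply: (filterS (F := nbhs (g y)) _ nA) => z; apply.
  have : nbhs y (g @^-1` A) by apply/(homeo_nbhs _ _ hg).
  by move=> H; apply: (filterS (F := nbhs y) _ H) => z ? _.
split; first exact/(homeo_compact _ hg).
by rewrite /closed homeo_closure //; move: clA => /closure_id <-.
Qed.


Lemma metrizable_hausdorff (T : topologicalType) :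
  metrizable R T -> hausdorff_space T.
Proof.
move=> [M [h hh]]; have [g [gg hg gh]] := homeo_inv hh.
move=> x y cxy; rewrite -[x]hg -[y]hg; congr g; apply: metric_hausdorff.
move=> A B /(homeo_nbhs _ _ hh) nA /(homeo_nbhs _ _ hh) nB.
by have [z [Az Bz]] := cxy _ _ nA nB; exists (h z).
Qed.

Lemma metrizable_completely_regular (T : topologicalType) :
  metrizable R T -> completely_regular_space T.
Proof.
move=> [M [h hh]] a B clB Ba; have [g [hg hK gK]] := homeo_inv hh.
have clB' : closed (g @^-1` B).
  by rewrite /closed homeo_closure //; move: clB => /closure_id <-.
have ga : ~ (g @^-1` B) (h a) by rewrite /= hK.
have /(@uniform_separatorP _ R) [f [cf f01 f0 f1]] :=
  @uniform_completely_regular R _ _ _ clB' ga.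
apply/(@uniform_separatorP _ R); exists (f \o h); split.
- have [? [_ _ ch _]] := hh.
  by move=> x; apply: continuous_comp; [exact: ch|exact: cf].
- by move=> _ [x _ <-]; apply: f01; exists (h x).
- by move=> _ [_ -> <-]; apply: f0; exists (h a).
- by move=> _ [x Bx <-]; apply: f1; exists (h x) => //=; rewrite hK.
Qed.

End topological_facts.

Section stone_cech_facts.
Variables (R : realType) (X : topologicalType).

Lemma stone_cech_compact : compact [set: stone_cech R X].
Proof.
have cK : compact [set f : prod_topology (fun _ : unit_functions R X => R) | forall i, `[0, 1]%classic (f i)].
  by apply: (@tychonoff (unit_functions R X) (fun=> R) (fun=> `[0, 1]%classic)) => i; exact: segment_compact.
have cl : compact (closure (range (@evaluation R X))).
  apply: (subclosed_compact _ cK); first exact: closed_closure.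
  have hp : hausdorff_space (prod_topology (fun _ : unit_functions R X => R)).
    by apply: (@hausdorff_product (unit_functions R X) (fun=> R)) => _; exact: norm_hausdorff.
  have /closure_id -> := compact_closed hp cK.
  apply: closureS.
  by move=> _ [x _ <-] i; have [_] := set_valP i; apply; exists x.
move=> F PF _.
have [|z [clz Fz]] := cl (\val @ F) _.
  by apply: (filterS (F := F) _ filterT) => x _; exact: set_valP.
exists (exist _ z (mem_set clz)); split => // A B FA [_ [[V oV <-] Vz] VB].
have [||w [/= [u Au <-] Vw]] := Fz (\val @` A) V.
  by apply: (filterS (F := F) _ FA) => x Ax; exists x.
  exact: open_nbhs_nbhs.
by exists u; split => //; exact: VB.
Qed.

Lemma stone_cech_hausdorff : hausdorff_space (stone_cech R X).
Proof.
have hp : hausdorff_space (prod_topology (fun _ : unit_functions R X => R)).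
  by apply: (@hausdorff_product (unit_functions R X) (fun=> R)) => _; exact: norm_hausdorff.
move=> x y cxy; apply: val_inj; apply: hp => A B nA nB.
have [||] := cxy (\val @^-1` A) (\val @^-1` B).
- exact: (@initial_continuous _ _ set_val).
- exact: (@initial_continuous _ _ set_val).
by move=> z [Az Bz]; exists (\val z).
Qed.

Definition stone_cech_ext (f : unit_functions R X) (z : stone_cech R X) : R := \val z f.
Lemma stone_cech_ext_continuous f : continuous (stone_cech_ext f).
Proof.
move=> z; have H1 : {for z, continuous (set_val : stone_cech R X -> prod_topology _)}.
  exact: (@initial_continuous _ _ set_val).
have H2 := @proj_continuous (unit_functions R X) (fun=> R) f (set_val z).
exact: (continuous_comp H1 H2).
Qed.
Lemma stone_cech_extE f x : stone_cech_ext f (stone_cech_incl R x) = \val f x.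
Proof. by []. Qed.


Lemma stone_cech_incl_dense : dense (range (@stone_cech_incl R X)).
Proof.
move=> O [z Oz]; move: (Oz) => /[swap] [[V oV <-]] /=.
move=> Vz; have [_ [[x _ <-] Vx]] := set_valP z _ (open_nbhs_nbhs (conj oV Vz)).
by exists (stone_cech_incl R x); split => //; exists x.
Qed.

Lemma stone_cech_incl_embedding : metrizable R X -> embedding (@stone_cech_incl R X).
Proof.
move=> mX.
have sep : separate_points_from_closed (fun f : unit_functions R X => \val f).
  move=> U x cU Ux.
  have /(@uniform_separatorP _ R) [f [cf f01 f0 f1]] :=
    metrizable_completely_regular mX cU Ux.
  have uf : unit_functions R X f by [].
  exists (exist _ f (mem_set uf)) => /=; rewrite (f0 (f x)); last by exists x.
  move=> /(closureS f1); rewrite -(closure_id _).1; last exact: closed_eq.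
  by move=> /esym/eqP; rewrite oner_eq0.
have cts (f : unit_functions R X) : continuous (\val f : X -> R).
  by have [] := set_valP f.
have inj := join_product_inj sep (hausdorff_accessible (metrizable_hausdorff mX)).
split.
  by move=> x y [/inj]; apply; rewrite inE.
move=> U; rewrite (join_product_initial sep cts inj); split.
  by move=> [V oV <-]; exists (set_val @^-1` V) => //; exists V.
by move=> [_ [V oV <-] <-]; exists V.
Qed.
End stone_cech_facts.

Section extension_facts.
Variables (R : realType) (X : topologicalType).
Implicit Types (Y : one_point_extension R X) (U : nat -> set X).

Lemma ope_equiv_refl Y : ope_equiv Y Y.
Proof. by exists id => //; exists id; split=> // x; exact: cvg_id. Qed.

Lemma ope_equiv_sym Y Y' : ope_equiv Y Y' -> ope_equiv Y' Y.
Proof.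
move=> [f hf fi]; have [g [hg fg gf]] := homeo_inv hf; exists g => // x.
by rewrite -fi fg.
Qed.

Lemma ope_equiv_trans Y1 Y2 Y3 :
  ope_equiv Y1 Y2 -> ope_equiv Y2 Y3 -> ope_equiv Y1 Y3.
Proof.
move=> [f hf fi] [g hg gi]; exists (g \o f); first exact: homeo_comp.
by move=> x /=; rewrite fi gi.
Qed.

Lemma incl_neq Y x : ope_incl Y x <> ope_pt Y.
Proof.
have : range (ope_incl Y) (ope_incl Y x) by exists x.
by rewrite ope_range.
Qed.

Lemma ope_cases Y (y : Y) : y = ope_pt Y \/ exists x, y = ope_incl Y x.
Proof.
have [->|ny] := pselect (y = ope_pt Y); first by left.
right; have : range (ope_incl Y) y by rewrite ope_range.
by move=> [x _ <-]; exists x.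
Qed.

Lemma generates_equiv U Y Y' : ope_equiv Y Y' -> generates U Y -> generates U Y'.
Proof.
move=> /ope_equiv_sym[f hf fi] [oU bU].
have fp : f (ope_pt Y') = ope_pt Y.
  have [//|[x fx]] := ope_cases (f (ope_pt Y')).
  have [g [_ fg _]] := homeo_inv hf.
  by exfalso; apply: (@incl_neq Y' x); rewrite -(fg (ope_pt Y')) fx -fi fg.
have E n : ope_pt Y' |` ope_incl Y' @` U n = f @^-1` (ope_pt Y |` ope_incl Y @` U n).
  apply/seteqP; split=> [y [->|[x Ux <-]]|y /=].
  - by left.
  - by right; exists x.
  - have [->|[x ->]] := ope_cases y; first by left.
    rewrite fi => -[/incl_neq//|[x' Ux' xx']]; right; exists x' => //.
    have [g [_ fg _]] := homeo_inv hf.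
    by rewrite -(fg (ope_incl Y' x)) fi -xx' -fi fg.
split=> [n|W nW]; first by rewrite E; apply/(homeo_open _ hf).
have [g [hg fg gf]] := homeo_inv hf.
have nW' : nbhs (ope_pt Y) (g @^-1` W).
  by apply/(homeo_nbhs _ _ hg); rewrite -fp fg.
have [n nWn] := bU _ nW'; exists n; rewrite E => y /nWn /=; by rewrite fg.
Qed.

Lemma generates_star U U' Y : generates U Y -> generates U' Y ->
  \bigcap_n star (R := R) (U n) `<=` \bigcap_n star (U' n).
Proof.
move=> [oU bU] [oU' bU'] z zU n _.
have [|m mn] := bU (ope_pt Y |` ope_incl Y @` U' n).
  by apply: open_nbhs_nbhs; split => //; left.
have UU' : U m `<=` U' n.
  move=> x Ux; have [|/incl_neq//|[x' Ux' xx']] := mn (ope_incl Y x).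
    by right; exists x.
  by have [inj _] := ope_embedding Y; rewrite -(inj _ _ xx').
have := zU m I; rewrite /star /=; apply: closureS; exact: image_subset.
Qed.

Lemma exists_trace Y : exists U, extension_trace U /\ generates U Y.
Proof.
have [M [h hh]] := ope_metrizable Y.
have [g [hg hK gK]] := homeo_inv hh.
set p := h (ope_pt Y).
pose r n : R := 2^-1 ^+ n.
have r0 n : 0 < r n by rewrite /r exprn_gt0 // invr_gt0 ltr0n.
pose B n := h @^-1` ball p (r n).
have oB n : open (B n).
  apply/(homeo_open _ hh); rewrite openE => y; rewrite ballEmdist /= => py.
  apply/nbhs_ballP; exists (r n - mdist p y); first by rewrite /= subr_gt0.
  move=> z; rewrite ballEmdist /= ltrBrDl; apply: le_lt_trans.
  exact: metric_triangle.
have [einj eo] := ope_embedding Y.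
pose U n := ope_incl Y @^-1` B n.
have VB n : ope_pt Y |` ope_incl Y @` U n = B n.
  apply/seteqP; split=> [y [->|[x Ux <-]]|y By]; [|exact: Ux|].
    exact: (ballxx p (r0 n)).
  by have [->|[x yx]] := ope_cases y; [left|right; exists x; rewrite /U /= -?yx].
have iB W : nbhs (ope_pt Y) W -> exists n, B n `<=` W.
  move=> nW; have : nbhs p (g @^-1` W) by apply/(homeo_nbhs _ _ hg); rewrite hK.
  move=> /nbhs_ballP[e /= e0 eW].
  have [n rn] : exists n, r n < e.
    have [n _ H] := near_infty_natSinv_expn_lt (PosNum e0).
    by exists n; have := H n (leqnn _); rewrite /= /r exprVn div1r.
  exists n => y /(le_ball (ltW rn))/eW /=; by rewrite hK.
exists U; split; last first.
  by split=> [n|W /iB[n BW]]; [rewrite VB|exists n; rewrite VB].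
split=> [n|n|n|].
- by apply/eo; exists (B n).
- have [|y [By [x _ xy]]] := @ope_dense _ _ Y (B n) _ (oB n).
    by exists (ope_pt Y); rewrite -VB; left.
  by exists x; rewrite /U /= xy.
- move=> x clx; rewrite /U /B /=.
  pose C := h @^-1` ball (h (ope_incl Y x)) (r n.+1).
  have nC : nbhs (ope_incl Y x) C.
    by apply/(homeo_nbhs _ _ hh); exact: nbhsx_ballx.
  have [|z [Uz Cz]] := clx (ope_incl Y @^-1` C).
    move: nC; rewrite nbhsE => -[D [oD Dx] DC]; rewrite nbhsE.
    exists (ope_incl Y @^-1` D); last by move=> t /DC.
    by split => //; apply/eo; exists D.
  have -> : r n = r n.+1 + r n.+1.
    by rewrite [LHS]splitr /r exprS mulrC.
  apply: ball_triangle Uz _; exact: ball_sym.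
- apply/seteqP; split=> // x Ux.
  have hd : hausdorff_space Y := metrizable_hausdorff (ope_metrizable Y).
  apply: (@incl_neq Y x); apply: hd => A A' nA nA'.
  have [n BA] := iB _ nA'; exists (ope_incl Y x); split.
    exact: nbhs_singleton nA.
  by apply: BA; exact: (Ux n).
Qed.

Lemma lambdaE C Y U : extensions C -> C Y -> extension_trace U ->
  generates U Y -> lambda C = \bigcap_n star (U n).
Proof.
move=> [Y0 ->{C}] YY0 tU gU; rewrite /lambda.
case: xgetP => [V _ [tV [Y' Y'Y0 gV]]|/(_ U)[]]; last first.
  by split => //; exists Y.
have gV' : generates V Y.
  exact: (generates_equiv (ope_equiv_trans (ope_equiv_sym Y'Y0) YY0) gV).
by apply/seteqP; split; [exact: (generates_star gV' gU)|exact: (generates_star gU gV')].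
Qed.

Lemma lc_extensionsE C Y : extensions C -> C Y ->
  lc_extensions C <-> locally_compact [set: Y].
Proof.
move=> EC CY; split=> [[_ [Y' CY' lcY']]|lcY]; last by split => //; exists Y.
case: EC CY CY' => Y0 -> CY CY'.
have [f hf _] := ope_equiv_trans (ope_equiv_sym CY') CY.
exact: homeo_locally_compact hf lcY'.
Qed.
End extension_facts.

(* Main.v *)
Require Import Defs.
From mathcomp Require Import all_boot all_order all_algebra.
From mathcomp Require Import all_classical all_reals topology normedtype.

(** Let a trace [U] generate the extension [Y] of [X] by a point [p].  The
    local compactness of [Y] and the clopenness of the value of [lambda] at the
    class of [Y] amount to a single statement about [X]: there is an [N]
    such that the closure of [U N] minus [U n] is compact for all [n]
    ([compact_gaps]).

    Compact gaps mean that [Y] is locally compact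
    ([locally_compact_ope_gaps]).  If [p] has a compact neighborhood, it
    contains some [U N], and what remains of the closure of [U N] outside the
    neighborhood [p |` U n] of [p] is closed in a compact set.  Conversely,
    when the gaps are compact, a proper filter on the closure of [p |` U N]
    that does not cluster at [p] lives on one of the gaps, so it clusters there;
    at the points of [X], local compactness comes from that of [X].

    Compact gaps also mean that the intersection [Z] of the sets [star (U n)]
    is clopen ([clopen_bigcap_star_gaps]).  Two facts about the remainder carry
    this: a closed subset of [X] is compact iff its star is empty
    ([star_eq0P]), and disjoint closed sets have disjoint stars
    ([star_disjoint]), by normality of [X].  Compact gaps are invisible in the
    remainder, so [Z] is [star (U N)] and covers the remainder together with
    [star (~` U N)]; it misses that set, because it lies in
    [star (closure (U N.+1))].  Hence [Z] is open, and it is closed as an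
    intersection of closed sets.  Conversely, since [X] is locally
    compact, the remainder is compact ([remainder_compact]), and if [Z] is open
    it contains some [star (U N)] ([nested_closed_subset_open]).  Then the star
    of the gap between the closure of [U N.+1] and [U n] lies both in [Z],
    hence in [star (U n.+1)], and in [star (~` U n)]: it is empty. *)

Set Implicit Arguments.
Unset Strict Implicit.
Unset Printing Implicit Defensive.

Import numFieldNormedType.Exports.

Local Open Scope classical_set_scope.

(** * Embeddings and local compactness *)

Lemma locally_compactP (T : topologicalType) :
  locally_compact [set: T] <->
  forall x : T, exists2 A, nbhs x A & compact A /\ closed A.
Proof.
split=> [lcT x|lcT x _].
  have [A nA cA] := lcT x I; exists A => //.
  by apply: (filterS (F := nbhs x) _ nA) => y; apply.
have [A nA cA] := lcT x; exists A => //.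
by apply: (filterS (F := nbhs x) _ nA) => y.
Qed.

Lemma embedding_continuous (S T : topologicalType) (f : S -> T) :
  embedding f -> continuous f.
Proof. by move=> [_ fo]; apply/continuousP => V oV; apply/fo; exists V. Qed.

Lemma embedding_closure (S T : topologicalType) (f : S -> T) (A : set S) :
  embedding f -> f @^-1` closure (f @` A) = closure A.
Proof.
move=> ef; apply/seteqP; split=> x /= cAx B nB.
  move: nB; rewrite nbhsE => -[U [oU Ux] UB].
  have [V oV VU] := ((proj2 ef) U).1 oU.
  have [|_ [[y Ay <-] Vfy]] := cAx V.
    by apply: open_nbhs_nbhs; split => //; rewrite -VU in Ux.
  by exists y; split => //; apply: UB; rewrite -VU.
have [y [Ay By]] := cAx _ (embedding_continuous ef nB).
by exists (f y); split => //; exists y.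
Qed.

Lemma embedding_compact (S T : topologicalType) (f : S -> T) (A : set S) :
  embedding f -> compact (f @` A) -> compact A.
Proof.
move=> ef cA F PF FA.
have [|_ [[x Ax <-] cx]] := cA (f @ F) _.
  by apply: (filterS (F := F) _ FA) => x Ax; exists x.
exists x; split => // A' B FA'; rewrite nbhsE => -[U [oU Ux] UB].
have [V oV VU] := ((proj2 ef) U).1 oU.
have [||_ [[y A'y <-] Vfy]] := cx (f @` A') V.
- by apply: (filterS (F := F) _ FA') => y A'y; exists y.
- by apply: open_nbhs_nbhs; split => //; rewrite -VU in Ux.
by exists y; split => //; apply: UB; rewrite -VU.
Qed.

Lemma embedding_open_nbhs (S T : topologicalType) (f : S -> T) (x : S)
    (A : set S) :
  embedding f -> open (range f) -> nbhs x A -> nbhs (f x) (f @` A).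
Proof.
move=> ef orf; rewrite nbhsE => -[U [oU Ux] UA].
have [V oV VU] := ((proj2 ef) U).1 oU.
apply: (filterS (P := V `&` range f)).
  by move=> z [Vz [y _ yE]]; exists y => //; apply: UA; rewrite -VU /= yE.
apply: open_nbhs_nbhs; split; first exact: openI.
by split; [rewrite -VU in Ux|exists x].
Qed.

(** Let [U] be an open neighborhood of [x] in a compact [A], and take an
    open [V] whose preimage is [U].  The points of [range f] in [V] lie in [f @` A], which is
    compact, hence closed; by density all of [V] lies in it. *)
Lemma locally_compact_open_range (S T : topologicalType) (f : S -> T) :
  hausdorff_space T -> embedding f -> dense (range f) ->
  locally_compact [set: S] -> open (range f).
Proof.
move=> hT ef df /locally_compactP lcS; rewrite openE => _ [x _ <-].
have [A + [cA _]] := lcS x; rewrite nbhsE => -[U [oU Ux] UA].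
have cfA : closed (f @` A).
  apply: compact_closed => //; apply: continuous_compact => //.
  exact/continuous_subspaceT/embedding_continuous.
have [V oV VU] := ((proj2 ef) U).1 oU.
rewrite /interior nbhsE; exists V.
  by split => //; rewrite -VU in Ux.
suff : V `<=` f @` A by move=> VA y /VA[z _ <-]; exists z.
move=> v Vv; rewrite (closure_id (f @` A)).1 // => B.
rewrite nbhsE => -[W [oW Wv] WB].
have [||z [[Vz Wz] [y _ yE]]] := df (V `&` W).
- by exists v.
- exact: openI.
exists z; split; last exact: WB.
by exists y => //; apply: UA; rewrite -VU /= yE.
Qed.

Lemma set_val_embedding (T : topologicalType) (A : set T) :
  embedding (set_val : A -> T).
Proof. by split=> [|U]; first exact: val_inj. Qed.

Lemma compact_set_type (T : topologicalType) (A : set T) :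
  compact A -> compact [set: A].
Proof.
move=> cA; apply: (embedding_compact (@set_val_embedding T A)).
rewrite (_ : _ @` _ = A) //; apply/seteqP; split=> [_ [x _ <-]|x Ax].
  exact: set_valP.
by exists (exist _ x (mem_set Ax)).
Qed.

(** * Compactness and normality *)

(** Otherwise the sets [F n `\` O] would generate a proper filter, and any
    cluster point would lie in all of them. *)
Lemma nested_closed_subset_open (T : topologicalType) (F : nat -> set T)
    (O : set T) :
  compact [set: T] -> (forall n, closed (F n)) ->
  (forall m n, (m <= n)%N -> F n `<=` F m) ->
  open O -> \bigcap_n F n `<=` O -> exists N, F N `<=` O.
Proof.
move=> cT cF dF oO FO; apply: contrapT => noN.
pose G := filter_from [set: nat] (fun n => F n `\` O).
have PG : ProperFilter G.
  apply: filter_from_proper => [|n _].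
    apply: filter_from_filter => [|m n _ _]; first by exists 0%N.
    by exists (maxn m n) => // x [Fx Ox]; split; split => //;
      apply: dF Fx; rewrite ?leq_maxl ?leq_maxr.
  by apply/set0P/negP => /eqP; rewrite setD_eq0 => FnO; apply: noN; exists n.
have [|x [_ Gx]] := cT G PG; first by exists 0%N.
have clx n : (F n `\` O) x.
  have : closed (F n `\` O) by apply: closedI => //; exact: open_closedC.
  by move=> /closure_id -> B; apply: Gx; exists n.
by apply: (clx 0%N).2; apply: FO => n _; exact: (clx n).1.
Qed.

Lemma metrizable_normal (R : realType) (T : topologicalType) :
  metrizable R T -> normal_space T.
Proof.
move=> [M [h hh]]; have [g [hg hK gK]] := homeo_inv hh.
apply/(@normal_separatorP R) => A B clA clB AB0.
have clg D : closed D -> closed (g @^-1` D).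
  by move=> /closure_id cD; rewrite /closed homeo_closure -?cD.
have AB0' : g @^-1` A `&` g @^-1` B = set0 by rewrite -preimage_setI AB0 preimage_set0.
have /(@uniform_separatorP _ R) [f [cf f01 f0 f1]] :=
  (@normal_separatorP R M).1 pseudometric_normal _ _ (clg _ clA) (clg _ clB) AB0'.
apply/(@uniform_separatorP _ R); exists (f \o h); split.
- have [? [_ _ ch _]] := hh.
  by move=> x; apply: continuous_comp; [exact: ch|exact: cf].
- by move=> _ [x _ <-]; apply: f01; exists (h x).
- by move=> _ [x Ax <-]; apply: f0; exists (h x) => //=; rewrite hK.
- by move=> _ [x Bx <-]; apply: f1; exists (h x) => //=; rewrite hK.
Qed.

(** * Stars of closed sets in the remainder *)

Section star_theory.
Variables (R : realType) (X : topologicalType).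
Hypothesis X_metrizable : metrizable R X.
Local Notation star := (@star R X).
Local Notation incl := (@stone_cech_incl R X).

Lemma starS (A B : set X) : A `<=` B -> star A `<=` star B.
Proof. by move=> AB z; apply: closureS; exact: image_subset. Qed.

Lemma starU (A B : set X) : star (A `|` B) = star A `|` star B.
Proof. by rewrite /Defs.star image_setU closureU. Qed.

Lemma starT : star setT = setT.
Proof.
apply/seteqP; split=> // z _ B; rewrite nbhsE => -[U [oU Uz] UB].
have [|y [Uy ry]] := @stone_cech_incl_dense R X U _ oU.
  by exists (val z).
by exists y; split => //; exact: UB.
Qed.

Lemma closed_star (A : set X) : closed (star A).
Proof.
apply: preimage_closed; last exact: closed_closure.
by move=> z _; exact: initial_continuous.
Qed.

(** An empty star means that the closure of [A] in the Stone-Cech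
    compactification adds no point to [A], which is then compact itself. *)
Lemma star_eq0P (A : set X) : closed A -> compact A <-> star A = set0.
Proof.
have ei : embedding incl := stone_cech_incl_embedding X_metrizable.
move=> cA; split=> [coA|A0].
  apply/seteqP; split=> // z; rewrite /Defs.star /=.
  rewrite -(closure_id _).1; last first.
    apply: compact_closed; first exact: stone_cech_hausdorff.
    apply: continuous_compact => //.
    exact/continuous_subspaceT/embedding_continuous.
  by move=> [x _ xz]; apply: (set_valP z); exists x.
apply: (embedding_compact ei).
rewrite (_ : _ @` _ = closure (incl @` A)).
  apply: (subclosed_compact _ (@stone_cech_compact R X)) => //.
  exact: closed_closure.
apply/seteqP; split; first exact: subset_closure.
move=> z clz; have [[x _ xz]|nz] := pselect (range incl z).
  exists x => //; rewrite (closure_id A).1 // -(embedding_closure A ei).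
  by rewrite /= xz.
have : star A (exist _ z (mem_set nz)) by [].
by rewrite A0.
Qed.

(** A Urysohn function separating [A] from [B] extends continuously to the
    Stone-Cech compactification and separates the two closures there. *)
Lemma star_disjoint (A B : set X) : closed A -> closed B ->
  A `&` B = set0 -> star A `&` star B = set0.
Proof.
move=> clA clB AB0.
have /(@uniform_separatorP _ R) [f [cf f01 f0 f1]] :=
  (@normal_separatorP R X).1 (metrizable_normal X_metrizable) _ _ clA clB AB0.
have uf : unit_functions R X f by [].
pose F := stone_cech_ext (exist _ f (mem_set uf)).
have ext (D : set X) (c : R) : f @` D `<=` [set c] ->
    closure (incl @` D) `<=` F @^-1` [set c].
  move=> fD; have /closure_id -> : closed (F @^-1` [set c]).
    apply: preimage_closed; last exact: closed_eq.
    by move=> z _; exact: stone_cech_ext_continuous.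
  by apply: closureS => _ [x Dx <-]; apply: fD; exists x.
apply/seteqP; split=> // z [/(ext _ _ f0) /= F0 /(ext _ _ f1) /=].
by rewrite F0 => /esym/eqP; rewrite GRing.oner_eq0.
Qed.

(** Local compactness makes [X] open in its compactification, so that the
    remainder is closed in a compact space. *)
Lemma remainder_compact : locally_compact [set: X] ->
  compact [set: remainder R X].
Proof.
move=> lcX; apply: compact_set_type.
apply: (subclosed_compact _ (@stone_cech_compact R X)) => //.
apply: open_closedC; apply: locally_compact_open_range => //.
- exact: stone_cech_hausdorff.
- exact: stone_cech_incl_embedding.
- exact: stone_cech_incl_dense.
Qed.

End star_theory.

(** * Clopen values of lambda *)

(** Since a trace decreases, the compactness of these differences says that
    beyond some index the traces differ by relatively compact sets only.  It is
    the common form, inside [X], of both sides of the theorem. *)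
Definition compact_gaps (X : topologicalType) (U : nat -> set X) :=
  exists N, forall n, compact (closure (U N) `\` U n).

Section trace_theory.
Variables (R : realType) (X : topologicalType) (U : nat -> set X).
Hypothesis traceU : extension_trace U.
Local Notation star := (@star R X).

Lemma extension_trace_decreasing m n : (m <= n)%N -> U n `<=` U m.
Proof.
have [_ _ clU _] := traceU.
apply: (@homo_leq _ U (fun A B => B `<=` A)) => [A //|B A C AB BC|k].
  exact: (subset_trans BC AB).
by move=> x Ux; apply: clU; exact: subset_closure.
Qed.

Let closed_gap m n : closed (closure (U m) `\` U n).
Proof.
have [oU _ _ _] := traceU.
by apply: closedI; [exact: closed_closure|exact: open_closedC].
Qed.

Lemma clopen_bigcap_star_gaps : metrizable R X -> locally_compact [set: X] ->
  clopen (\bigcap_n star (U n)) <-> compact_gaps U.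
Proof.
move=> mX lcX; have [oU _ clU _] := traceU.
have starsep n : star (closure (U n.+1)) `&` star (~` U n) = set0.
  apply: star_disjoint => //; [exact: closed_closure|exact: open_closedC|].
  by apply/disjoints_subset; rewrite setCK.
split=> [[oZ cZ]|[N cN]].
  have [||N NZ] := @nested_closed_subset_open _ (fun n => star (U n)) _
      (remainder_compact mX lcX) _ _ oZ (@subset_refl _ _).
  - by move=> n; exact: closed_star.
  - by move=> m n mn; apply: starS; exact: extension_trace_decreasing.
  (* The index is [N.+1] because only the closure of [U N.+1], and not that of
     [U N], is known to lie in [U N]. *)
  exists N.+1 => n; apply/(star_eq0P mX) => //.
  apply/seteqP; split=> // z gapz; rewrite -(starsep n); split.
    have : star (U N) z.
      by apply: starS gapz => x [/clU].
    move=> /NZ /(_ n.+1 I); apply: starS; exact: subset_closure.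
  by apply: starS gapz => x [].
have NZ : star (U N) `<=` \bigcap_n star (U n).
  move=> z zN n _.
  have : star (U n `|` (closure (U N) `\` U n)) z.
    apply: starS zN => x UNx.
    have [|nUx] := pselect (U n x); [by left|right; split => //].
    exact: subset_closure.
  by rewrite starU ((star_eq0P mX (@closed_gap N n)).1 (cN n)) setU0.
have ZC : ~` (\bigcap_n star (U n)) = star (~` U N).
  apply/seteqP; split=> z.
    have : star (U N `|` ~` U N) z by rewrite setUCr starT.
    by rewrite starU => -[/NZ|].
  move=> zC /(_ N.+1 I) zN.
  have : (star (closure (U N.+1)) `&` star (~` U N)) z.
    by split => //; apply: starS zN; exact: subset_closure.
  by rewrite starsep.
split; first by rewrite -closedC ZC; exact: closed_star.
by apply: closed_bigI => n _; exact: closed_star.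
Qed.

End trace_theory.

(** * Local compactness of an extension *)

Section extension_theory.
Variables (R : realType) (X : topologicalType) (U : nat -> set X).
Variable Y : one_point_extension R X.
Hypothesis genU : generates U Y.
Local Notation f := (ope_incl Y).
Local Notation p := (ope_pt Y).

Lemma locally_compact_ope_gaps : locally_compact [set: X] ->
  locally_compact [set: Y] <-> compact_gaps U.
Proof.
move=> lcX; have [oV bV] := genU.
have hY : hausdorff_space Y := metrizable_hausdorff (ope_metrizable Y).
have clp : closed [set p] by apply: accessible_closed_set1; exact: hausdorff_accessible.
have orf : open (range f) by rewrite ope_range; exact: closed_openC.
have ef := ope_embedding Y.
rewrite locally_compactP; split=> [lcY|[N cN]].
  have [K /bV[N VK] [cK clK]] := lcY p.
  exists N => n; apply: (embedding_compact ef).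
  (* This writes the gap, inside [Y], as a closed subset of [K]. *)
  have -> : f @` (closure (U N) `\` U n) =
      closure (f @` U N) `\` (p |` f @` U n).
    apply/seteqP; split=> [_ [x [cUx nUx] <-]|y [cy nVy]].
      split; first by move: cUx; rewrite -(embedding_closure (U N) ef).
      by move=> [/incl_neq//|[x' Ux' /(proj1 ef) xx']]; apply: nUx; rewrite -xx'.
    have [yp|[x yx]] := ope_cases y; first by case: nVy; left.
    exists x => //; split; first by rewrite -(embedding_closure (U N) ef) /= -yx.
    by move=> Ux; apply: nVy; right; exists x.
  apply: (subclosed_compact _ cK).
    by apply: closedI; [exact: closed_closure|exact: open_closedC].
  move=> y [cy _]; rewrite (closure_id K).1 //; apply: closureS cy => z fUz.
  by apply: VK; right.
move=> y; have [->|[x ->]] := ope_cases y; last first.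
  have [A nA [cA _]] := (locally_compactP X).1 lcX x.
  exists (f @` A); first exact: embedding_open_nbhs.
  have cfA : compact (f @` A).
    apply: continuous_compact => //.
    exact/continuous_subspaceT/embedding_continuous.
  by split => //; exact: compact_closed.
exists (closure (p |` f @` U N)).
  apply: (filterS (F := nbhs p) (@subset_closure _ _)).
  by apply: open_nbhs_nbhs; split => //; left.
split; last exact: closed_closure.
move=> F PF FK; have [cFp|] := pselect (cluster F p).
  by exists p; split => //; apply: subset_closure; left.
move=> /existsNP[A] /existsNP[W] /not_implyP[FA] /not_implyP[/bV[n VW] AW0].
(* [A] misses [p |` U n], so [F] contains the image of the [n]-th gap. *)
have [|z [_ cz]] := continuous_compact
    (continuous_subspaceT (embedding_continuous ef)) (cN n) PF.
  apply: (filterS _ (filterI FA FK)) => z [Az].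
  have nVz : ~ (p |` f @` U n) z by move=> /VW Wz; apply: AW0; exists z.
  rewrite closureU -(closure_id [set p]).1 // => -[zp|cz].
    by case: nVz; left.
  have [zp|[x zx]] := ope_cases z; first by case: nVz; left.
  exists x => //; split; first by rewrite -(embedding_closure (U N) ef) /= -zx.
  by move=> Ux; apply: nVz; right; exists x.
exists z; split => //; apply: closed_closure => B nB.
exact: cz FK nB.
Qed.

End extension_theory.

Theorem theorem3p2 (R : realType) (X : topologicalType)
    (X_metrizable : metrizable R X)
    (X_locally_compact : locally_compact [set: X])
    (X_noncompact : ~ compact [set: X]) :
  lambda_image (@lc_extensions R X) =
  [set Z | lambda_image (@extensions R X) Z /\ clopen Z].
Proof.
have lc_clopen (C : one_point_extension R X -> Prop) :
    extensions C -> lc_extensions C <-> clopen (lambda C).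
  move=> EC; have [Y CE] := EC; have CY : C Y by rewrite CE; exact: ope_equiv_refl.
  have [U [tU gU]] := exists_trace Y.
  rewrite (lc_extensionsE EC CY) (lambdaE EC CY tU gU).
  by rewrite (locally_compact_ope_gaps gU) // clopen_bigcap_star_gaps.
apply/seteqP; split=> [_ [C lcC <-]|_ [[C EC <-] oC]].
  have [EC _] := lcC; split; first by exists C.
  exact/(lc_clopen _ EC).
by exists C => //; exact/(lc_clopen _ EC).
Qed.
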